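(* Let $c\neq 0$ be a real constant. Let $\gamma$ be a centroaffine curve and let $\delta=f\gamma+c\gamma'$ be a centroaffine curve $c$-related to $\gamma$, where $f$ is a $\pi$-periodic function. Let the curves $\gamma$ and $\delta$ evolve by the KdV flow. Then they remain $c$-related, and the function $f$ (defined at each time by $\delta=f\gamma+c\gamma'$) evolves according to $$\dot f=-\frac12 f'''+\frac{3}{c^2}(f^2-1)f',$$ where dot is the derivative with respect to the time of the flow and prime is the derivative with respect to the curve parameter $t$.
   Context: For $u,v\in\mathbb{R}^2$, $[u,v]$ denotes the determinant of the matrix with columns $u,v$. A centroaffine curve is a smooth curve $\gamma:\mathbb{R}\to\mathbb{R}^2$ with $[\gamma(t),\gamma'(t)]=1$ for all $t$; all curves are assumed $\pi$-anti-periodic: $\gamma(t+\pi)=-\gamma(t)$. Its centroaffine curvature is the $\pi$-periodic function $p$ with $\gamma''=p\gamma$. Two centroaffine curves $\gamma,\delta$ are $c$-related if $[\gamma(t),\delta(t)]=c$ for all $t$. The KdV flow on centroaffine curves is the evolution $\dot\gamma=-\frac12 p'\gamma+p\gamma'$, where $p$ is the centroaffine curvature of $\gamma$ at the given time; under it $\dot p=-\frac12p'''+3pp'$. Thus $\delta$ evolves by $\dot\delta=-\frac12 q'\delta+q\delta'$ where $\delta''=q\delta$. Evolutions are assumed smooth in time and in $t$. *)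

(* Defs.v *)
From Stdlib Require Import Reals.
From Coquelicot Require Import Coquelicot.
Open Scope R_scope.

Definition det (u v : R * R) : R := fst u * snd v - fst v * snd u.

(* Coquelicot's [Derive] only takes real-valued functions, hence the
   componentwise definition. *)
Definition curve_deriv (g : R -> R * R) (t : R) : R * R :=
  (Derive (fun x => fst (g x)) t, Derive (fun x => snd (g x)) t).

Definition smooth_curve (g : R -> R * R) : Prop :=
  forall (n : nat) (t : R),
    ex_derive_n (fun x => fst (g x)) n t /\
    ex_derive_n (fun x => snd (g x)) n t.

Definition centroaffine (g : R -> R * R) : Prop :=
  smooth_curve g /\
  (forall t, det (g t) (curve_deriv g t) = 1) /\
  (forall t, g (t + PI) = opp (g t)).

(* Such a [p] exists and is unique for every centroaffine curve [g]. *)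
Definition is_curvature (g : R -> R * R) (p : R -> R) : Prop :=
  (forall t, p (t + PI) = p t) /\
  (forall t, curve_deriv (curve_deriv g) t = scal (p t) (g t)).

Definition c_related (c : R) (g d : R -> R * R) : Prop :=
  forall t, det (g t) (d t) = c.

Definition in_open_interval (a b : Rbar) (s : R) : Prop :=
  Rbar_lt a s /\ Rbar_lt s b.

(* [ex_diff_n h n s t] at every point of the open strip ]a, b[ x R says that
   all partial derivatives of [h] of order at most [n] exist and are continuous
   there: this is joint smoothness in the time [s] and the parameter [t]. *)
Definition smooth_evolution (a b : Rbar) (g : R -> R -> R * R) : Prop :=
  forall (n : nat) (s t : R), in_open_interval a b s ->
    ex_diff_n (fun s' t' => fst (g s' t')) n s t /\
    ex_diff_n (fun s' t' => snd (g s' t')) n s t.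

(* [g s] is the curve at time [s]; values at times outside ]a, b[ are
   irrelevant. *)
Definition kdv_flow (a b : Rbar) (g : R -> R -> R * R) : Prop :=
  smooth_evolution a b g /\
  forall s, in_open_interval a b s ->
    centroaffine (g s) /\
    exists p : R -> R,
      is_curvature (g s) p /\
      forall t,
        is_derive (fun s' => g s' t) s
          (plus (scal (- (1 / 2) * Derive p t) (g s t))
                (scal (p t) (curve_deriv (g s) t))).

Definition is_coefficient (c : R) (g d : R -> R * R) (f : R -> R) : Prop :=
  (forall t, f (t + PI) = f t) /\
  (forall t, d t = plus (scal (f t) (g t)) (scal c (curve_deriv g t))).

(* Main.v *)
Require Import Defs.
From Stdlib Require Import Reals Lra Lia ClassicalEpsilon Classical.
From Coquelicot Require Import Coquelicot.
Open Scope R_scope.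

(** Write [u,v] for the determinant, p and q for the curvatures of gamma and
    delta. Each component phi of gamma solves the Lax pair of KdV,
      phi'' = p phi,   phi_s = - p' phi / 2 + p phi',
    and each component psi of delta solves the same pair with q in place of p.

    The first point is that c-relatedness persists. For the product V = phi psi
    the two equations of the Lax pairs combine to the linear equation
      V_s = - V''' / 2 + (3/2) (p + q) V'
    ([lax_product_evolution]). Hence W = [gamma,delta] - c, being a combination
    of such products and a constant, satisfies it too. It is periodic in t and
    vanishes at the initial time. The energy method applies: the third order
    term is antisymmetric, the coefficient of W' is smooth, so the integral of
    W^2 over a period grows at most exponentially and therefore stays zero, in
    both time directions ([dispersive_zero], [kdv_det_constant]). This avoids
    any appeal to well-posedness of KdV itself.

    The second point is the equation for f. Since [gamma,gamma'] = 1, the only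
    possible coefficient is f = [delta,gamma']. Differentiating [gamma,delta] = c
    twice in t gives f' = c (q - p) / 2, and Pluecker's relation for gamma,
    gamma', delta, delta' gives f^2 - 1 = c^2 (p + q) / 2; together these are
    the Miura transformation ([miura]). The Lax pair, and its t-derivative
    obtained by exchanging partial derivatives, express f_s through p, q and
    their derivatives, and the Miura relations turn this into mKdV
    ([coefficient_mkdv]). *)

(** * Calculus of functions of one variable *)

Definition smooth_fn (h : R -> R) : Prop := forall n t, ex_derive_n h n t.

Lemma smooth_fn_ex_derive (h : R -> R) (t : R) : smooth_fn h -> ex_derive h t.
Proof. intros sh. exact (sh 1%nat t). Qed.

Lemma smooth_fn_Derive (h : R -> R) : smooth_fn h -> smooth_fn (Derive h).
Proof.
  intros sh [|n] t; [exact I|].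
  apply (ex_derive_ext (Derive_n h (S n))); [|exact (sh (S (S n)) t)].
  intros u. generalize (Derive_n_comp h n 1 u). rewrite Nat.add_1_r. easy.
Qed.

Lemma ex_derive_n_S (h : R -> R) (n : nat) (t : R) :
  ex_derive h t -> ex_derive_n (Derive h) n t -> ex_derive_n h (S n) t.
Proof.
  destruct n as [|n]; [easy|]. intros _ eh.
  apply (ex_derive_ext (Derive_n (Derive h) n)); [|exact eh].
  intros u. generalize (Derive_n_comp h n 1 u). rewrite Nat.add_1_r. easy.
Qed.

Lemma smooth_fn_minus (h k : R -> R) :
  smooth_fn h -> smooth_fn k -> smooth_fn (fun t => h t - k t).
Proof.
  intros sh sk n t. apply ex_derive_n_minus; apply filter_forall;
  intros; [apply sh | apply sk].
Qed.

Lemma smooth_fn_mult (h k : R -> R) :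
  smooth_fn h -> smooth_fn k -> smooth_fn (fun t => h t * k t).
Proof.
  intros sh sk n. revert h k sh sk.
  induction n as [n IH] using Wf_nat.lt_wf_ind. intros h k sh sk t.
  destruct n as [|n]; [exact I|].
  apply ex_derive_n_S.
  - apply (ex_derive_mult h k t); apply smooth_fn_ex_derive; assumption.
  - apply (ex_derive_n_ext (fun t => Derive h t * k t + h t * Derive k t)).
    + intros u. symmetry. apply Derive_mult; apply smooth_fn_ex_derive; assumption.
    + apply ex_derive_n_plus; apply filter_forall; intros u i hi;
      apply IH; try lia; auto using smooth_fn_Derive.
Qed.

Lemma derive_mult (h k : R -> R) (t dh dk : R) :
  is_derive h t dh -> is_derive k t dk ->
  is_derive (fun x => h x * k x) t (dh * k t + h t * dk).
Proof. intros H K. apply (is_derive_mult h k t dh dk H K). exact Rmult_comm. Qed.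

Lemma derive_plus (h k : R -> R) (t dh dk : R) :
  is_derive h t dh -> is_derive k t dk ->
  is_derive (fun x => h x + k x) t (dh + dk).
Proof. exact (is_derive_plus h k t dh dk). Qed.

Lemma derive_const (k t : R) : is_derive (fun _ : R => k) t 0.
Proof. exact (is_derive_const k t). Qed.

Lemma is_derive_eq (h : R -> R) (t l l' : R) :
  is_derive h t l -> l = l' -> is_derive h t l'.
Proof. now intros H <-. Qed.

Lemma derive_minus (h k : R -> R) (t dh dk : R) :
  is_derive h t dh -> is_derive k t dk ->
  is_derive (fun x => h x - k x) t (dh - dk).
Proof. exact (is_derive_minus h k t dh dk). Qed.

(** * The strip of times, compactness and Gronwall's inequality *)

Lemma open_strip (a b : Rbar) (s : R) :
  in_open_interval a b s -> locally s (in_open_interval a b).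
Proof.
  intros [h1 h2]. apply filter_and.
  - exact (open_Rbar_gt a s h1).
  - exact (open_Rbar_lt b s h2).
Qed.

Lemma open_strip_2d (a b : Rbar) (P : R -> R -> Prop) (s t : R) :
  (forall s t, in_open_interval a b s -> P s t) ->
  in_open_interval a b s -> locally_2d P s t.
Proof.
  intros H hs. destruct (open_strip a b s hs) as [d hd].
  exists d. intros u v hu hv. apply H, hd, hu.
Qed.

Lemma interval_convex (a b : Rbar) (r s u : R) :
  in_open_interval a b r -> in_open_interval a b s ->
  Rmin r s <= u <= Rmax r s -> in_open_interval a b u.
Proof.
  intros [h1 h2] [h3 h4] [h5 h6]. split.
  - apply (Rbar_lt_le_trans _ (Rmin r s)); [|exact h5].
    unfold Rmin. destruct Rle_dec; assumption.
  - apply (Rbar_le_lt_trans _ (Rmax r s)); [exact h6|].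
    unfold Rmax. destruct Rle_dec; assumption.
Qed.

(** Supplies one Gronwall constant that works for all times between two given
    times. *)
Lemma bounded_on_rectangle (g : R -> R -> R) (a b c d : R) :
  (forall x y, a <= x <= b -> c <= y <= d -> continuity_2d_pt g x y) ->
  exists K, forall x y, a <= x <= b -> c <= y <= d -> Rabs (g x y) <= K.
Proof.
  intros cg.
  (* The radius of the neighbourhood also encodes the local bound: on the ball
     of radius e the function is at most 1/e. A common lower bound for the radii
     then bounds the function everywhere. *)
  assert (H : forall u v, exists e : posreal,
    a <= u <= b -> c <= v <= d ->
    forall x y, Rabs (x - u) < e -> Rabs (y - v) < e -> Rabs (g x y) <= / e).
  { intros u v.
    destruct (classic (a <= u <= b /\ c <= v <= d)) as [[hu hv]|n];
      [|exists (mkposreal 1 Rlt_0_1); tauto].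
    destruct (cg u v hu hv (mkposreal 1 Rlt_0_1)) as [e he]; simpl in he.
    assert (pM : 0 < / (Rabs (g u v) + 1)).
    { apply Rinv_0_lt_compat. generalize (Rabs_pos (g u v)); lra. }
    assert (pm : 0 < Rmin e (/ (Rabs (g u v) + 1))).
    { apply Rmin_pos; [apply cond_pos | exact pM]. }
    exists (mkposreal _ pm); simpl. intros _ _ x y hx hy.
    generalize (Rmin_l e (/ (Rabs (g u v) + 1)))
               (Rmin_r e (/ (Rabs (g u v) + 1))); intros l1 l2.
    apply Rle_trans with (Rabs (g u v) + 1).
    - assert (Rabs (g x y - g u v) < 1) by (apply he; lra).
      generalize (Rabs_triang_inv (g x y) (g u v)); lra.
    - apply (Rle_trans _ (/ / (Rabs (g u v) + 1))).
      + rewrite Rinv_inv. apply Rle_refl.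
      + apply Rinv_le_contravar; assumption. }
  pose (r := fun u v => proj1_sig (constructive_indefinite_description _ (H u v))).
  assert (hr : forall u v, a <= u <= b -> c <= v <= d ->
    forall x y, Rabs (x - u) < r u v -> Rabs (y - v) < r u v ->
    Rabs (g x y) <= / r u v).
  { intros u v. unfold r.
    destruct (constructive_indefinite_description _ (H u v)) as [e he]. exact he. }
  destruct (compactness_value_2d a b c d r) as [e he].
  exists (/ e). intros x y hx hy.
  destruct (NNPP _ (he x y hx hy)) as [u [v [hu [hv [h1 [h2 h3]]]]]].
  apply Rle_trans with (/ r u v); [now apply hr|].
  apply Rinv_le_contravar; [apply cond_pos | exact h3].
Qed.

(** Since r and s come in no particular order, this covers both directions of
    time: e^(-Kx) E(x) is nonincreasing and e^(Kx) E(x) is nondecreasing. *)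
Lemma gronwall_zero (E dE : R -> R) (K r s : R) :
  (forall x, Rmin r s <= x <= Rmax r s -> is_derive E x (dE x)) ->
  (forall x, Rmin r s <= x <= Rmax r s -> Rabs (dE x) <= K * E x) ->
  E r = 0 -> E s <= 0.
Proof.
  intros hd hK h0.
  (* Mean value theorem for e^(kx) E(x), to be used with k = -K or k = K
     according to the direction of time. *)
  assert (step : forall k, exists x, Rmin r s <= x <= Rmax r s /\
    exp (k * s) * E s = exp (k * x) * (k * E x + dE x) * (s - r)).
  { intros k.
    assert (hg : forall x, Rmin r s <= x <= Rmax r s ->
      is_derive (fun x => exp (k * x) * E x) x (exp (k * x) * (k * E x + dE x))).
    { intros x hx. generalize (hd x hx); intros dx.
      auto_derive; [exists (dE x); exact dx|].
      change (Derive (fun y => E y) x) with (Derive E x).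
      rewrite (is_derive_unique _ _ _ dx). ring. }
    destruct (MVT_gen _ r s _ (fun x hx =>
      hg x (conj (Rlt_le _ _ (proj1 hx)) (Rlt_le _ _ (proj2 hx))))) as [x [hx e]].
    { intros x hx. apply derivable_continuous_pt, ex_derive_Reals_0.
      eexists. exact (hg x hx). }
    exists x. split; [exact hx|]. rewrite <- e, h0. ring. }
  destruct (Rle_dec r s) as [le|gt].
  - destruct (step (- K)) as [x [hx e]].
    generalize (hK x hx) (Rle_abs (dE x)) (exp_pos (- K * x)) (exp_pos (- K * s)).
    intros h1 h2 h3 h4.
    apply (Rmult_le_reg_l _ _ _ h4). rewrite e, Rmult_0_r.
    assert (exp (- K * x) * (- K * E x + dE x) <= 0) by nra. nra.
  - destruct (step K) as [x [hx e]].
    generalize (hK x hx) (Rle_abs (- dE x)) (exp_pos (K * x)) (exp_pos (K * s)).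
    rewrite Rabs_Ropp. intros h1 h2 h3 h4.
    apply (Rmult_le_reg_l _ _ _ h4). rewrite e, Rmult_0_r.
    assert (0 <= exp (K * x) * (K * E x + dE x)) by nra. nra.
Qed.

(** The integral of h^2 from l to x is nondecreasing in x and vanishes at both
    ends, hence is constant, and its derivative at t is h(t)^2. *)
Lemma RInt_square_zero (h : R -> R) (l r t : R) :
  (forall x, continuous h x) -> l < t < r ->
  RInt (fun x => h x ^ 2) l r <= 0 -> h t = 0.
Proof.
  intros ch [lt tr] hI.
  assert (cq : forall x, continuous (fun x => h x ^ 2) x).
  { intros x. apply (continuous_ext (fun x => mult (h x) (h x)));
      [intros; unfold mult; simpl; ring | apply (continuous_mult h h x); apply ch]. }
  assert (ei : forall x y, ex_RInt (fun x => h x ^ 2) x y)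
    by (intros; apply (ex_RInt_continuous (V:=R_CompleteNormedModule)); intros; apply cq).
  assert (pos : forall x y, x <= y -> 0 <= RInt (fun x => h x ^ 2) x y)
    by (intros; apply RInt_ge_0; auto using pow2_ge_0).
  assert (zero : forall x, l < x < r -> RInt (fun x => h x ^ 2) l x = 0).
  { intros x hx.
    assert (e : RInt (fun x => h x ^ 2) l x + RInt (fun x => h x ^ 2) x r
                = RInt (fun x => h x ^ 2) l r)
      by exact (RInt_Chasles _ _ _ _ (ei l x) (ei x r)).
    assert (0 <= RInt (fun x => h x ^ 2) l x) by (apply pos; lra).
    assert (0 <= RInt (fun x => h x ^ 2) x r) by (apply pos; lra).
    lra. }
  assert (d1 : is_derive (fun y => RInt (fun x => h x ^ 2) l y) t (h t ^ 2)).
  { apply (is_derive_RInt (fun x => h x ^ 2) _ l); [|apply cq].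
    apply filter_forall; intros y. exact (RInt_correct _ _ _ (ei l y)). }
  assert (d0 : is_derive (fun y => RInt (fun x => h x ^ 2) l y) t 0).
  { apply (is_derive_ext_loc (fun _ => 0)); [|apply @is_derive_const].
    apply (filter_imp (fun y => l < y /\ y < r)).
    - intros y hy. symmetry. now apply zero.
    - apply filter_and; [now apply open_gt | now apply open_lt]. }
  generalize (is_derive_unique _ _ _ d1) (is_derive_unique _ _ _ d0).
  intros -> e. destruct (Rmult_integral (h t) (h t)); lra.
Qed.

(** * Uniqueness for a linear dispersive equation *)

Lemma differentiable_continuous (h : R -> R) (t : R) :
  ex_derive h t -> continuous h t.
Proof. exact (ex_derive_continuous h t). Qed.

Lemma Derive_periodic (h : R -> R) (T t : R) :
  smooth_fn h -> (forall x, h (x + T) = h x) ->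
  Derive h (t + T) = Derive h t.
Proof.
  intros sh ph. symmetry.
  rewrite <- (Derive_ext (fun x => h (x + T)) h t ph).
  apply is_derive_unique.
  generalize (Derive_correct _ _ (smooth_fn_ex_derive h (t + T) sh)); intros d.
  auto_derive; [now apply smooth_fn_ex_derive|].
  change (Derive (fun x => h x)) with (Derive h). ring.
Qed.

(** Energy method. Integrating by parts over full periods, the derivative of the
    integral of w^2 equals minus the integral of u' w^2: the third order term
    contributes nothing, and u' is bounded on compact sets, so Gronwall applies. *)
Lemma dispersive_zero (a b : Rbar) (s0 : R) (w u : R -> R -> R) :
  in_open_interval a b s0 ->
  (forall s, in_open_interval a b s -> smooth_fn (w s)) ->
  (forall s t, in_open_interval a b s -> w s (t + PI) = w s t) ->
  (forall s t, in_open_interval a b s -> u s (t + PI) = u s t) ->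
  (forall s t, in_open_interval a b s -> ex_derive (u s) t) ->
  (forall s t, in_open_interval a b s ->
     continuity_2d_pt (fun s t => Derive (u s) t) s t) ->
  (forall s t, in_open_interval a b s -> continuity_2d_pt w s t) ->
  (forall s t, in_open_interval a b s ->
     continuity_2d_pt (fun s t => Derive (fun s' => w s' t) s) s t) ->
  (forall s t, in_open_interval a b s ->
     is_derive (fun s' => w s' t) s
       (- (1 / 2) * Derive_n (w s) 3 t + u s t * Derive (w s) t)) ->
  (forall t, w s0 t = 0) ->
  forall s t, in_open_interval a b s -> w s t = 0.
Proof.
  intros hs0 sw pw pu du cdu cw cdw evol init s1 t0 hs1.
  (* Two full periods centred at t0, so that t0 is an interior point. *)
  pose (l := t0 - PI). pose (r := t0 + PI).
  generalize PI_RGT_0; intros pi0.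
  assert (lr : l < r) by (unfold l, r; lra).
  assert (lr' : l <= r) by lra.
  assert (ends : forall h : R -> R, (forall t, h (t + PI) = h t) -> h r = h l).
  { intros h ph. unfold r, l. rewrite ph, <- (ph (t0 - PI)). f_equal. ring. }
  assert (inside : forall s, Rmin s0 s1 <= s <= Rmax s0 s1 -> in_open_interval a b s)
    by (intros s hs; exact (interval_convex a b s0 s1 s hs0 hs1 hs)).
  destruct (bounded_on_rectangle (fun s t => Derive (u s) t)
    (Rmin s0 s1) (Rmax s0 s1) l r) as [K hK]; [auto|].
  assert (cq : forall s t, in_open_interval a b s -> continuous (fun t => w s t ^ 2) t).
  { intros s t hs. apply differentiable_continuous.
    auto_derive. now apply smooth_fn_ex_derive, sw. }
  assert (cu : forall s t, in_open_interval a b s -> continuous (Derive (u s)) t).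
  { intros s t hs. apply continuity_pt_filterlim.
    intros e he. destruct (cdu s t hs (mkposreal e he)) as [d hd].
    exists d. split; [apply cond_pos|]. intros x [_ hx].
    apply hd; [rewrite Rminus_diag, Rabs_R0; apply cond_pos | exact hx]. }
  assert (cuq : forall s t, in_open_interval a b s ->
    continuous (fun t => Derive (u s) t * w s t ^ 2) t).
  { intros s t hs. apply (continuous_mult (Derive (u s)) (fun t => w s t ^ 2) t); auto. }
  assert (iq : forall s, in_open_interval a b s -> ex_RInt (fun t => w s t ^ 2) l r).
  { intros s hs. apply (ex_RInt_continuous (V := R_CompleteNormedModule)). auto. }
  assert (iuq : forall s, in_open_interval a b s ->
    ex_RInt (fun t => Derive (u s) t * w s t ^ 2) l r).
  { intros s hs. apply (ex_RInt_continuous (V := R_CompleteNormedModule)). auto. }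
  assert (evolE : forall s t, in_open_interval a b s ->
    Derive (fun s' => w s' t) s
    = - (1 / 2) * Derive_n (w s) 3 t + u s t * Derive (w s) t)
    by (intros s t hs; exact (is_derive_unique _ _ _ (evol s t hs))).
  assert (dq : forall s t, in_open_interval a b s ->
    is_derive (fun s' => w s' t ^ 2) s (2 * w s t *
      (- (1 / 2) * Derive_n (w s) 3 t + u s t * Derive (w s) t))).
  { intros s t hs. auto_derive; [eexists; exact (evol s t hs)|].
    rewrite evolE by exact hs. ring. }
  assert (dqE : forall s t, in_open_interval a b s ->
    Derive (fun s' => w s' t ^ 2) s = 2 * w s t *
      (- (1 / 2) * Derive_n (w s) 3 t + u s t * Derive (w s) t))
    by (intros s t hs; exact (is_derive_unique _ _ _ (dq s t hs))).
  (* Multiplying the equation by 2w gives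
       (w^2)_s = - w w''' + 2 u w w' = (- w w'' + w'^2 / 2 + u w^2)' - u' w^2,
     and the flux in brackets takes the same value at both ends. *)
  assert (flux : forall s, in_open_interval a b s ->
    RInt (fun t => Derive (fun s' => w s' t ^ 2) s) l r
    = - RInt (fun t => Derive (u s) t * w s t ^ 2) l r).
  { intros s hs.
    pose proof (sw s hs) as dw0. pose proof (smooth_fn_Derive _ dw0) as dw1.
    pose proof (smooth_fn_Derive _ dw1) as dw2.
    pose proof (smooth_fn_Derive _ dw2) as dw3.
    pose (Phi := fun t => - (w s t * Derive (Derive (w s)) t)
                    + (1 / 2) * Derive (w s) t ^ 2 + u s t * w s t ^ 2).
    assert (dPhi : forall t, is_derive Phi t
      (Derive (fun s' => w s' t ^ 2) s + Derive (u s) t * w s t ^ 2)).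
    { intros t. rewrite dqE by exact hs. unfold Phi.
      auto_derive.
      - repeat split; try (now apply smooth_fn_ex_derive); now apply du.
      - change (Derive_n (w s) 3 t) with (Derive (Derive (Derive (w s))) t).
        change (Derive (fun x => w s x)) with (Derive (w s)).
        change (Derive (fun x => u s x)) with (Derive (u s)).
        change (Derive (fun x => Derive (w s) x)) with (Derive (Derive (w s))).
        change (Derive (fun x => Derive (Derive (w s)) x))
          with (Derive (Derive (Derive (w s)))).
        field. }
    assert (ePhi : Phi r = Phi l).
    { apply ends. intros t. unfold Phi.
      assert (p1 : forall t, Derive (w s) (t + PI) = Derive (w s) t)
        by (intros; apply Derive_periodic; auto).
      rewrite pw, pu, p1, (Derive_periodic (Derive (w s))); auto. }
    assert (cd : forall t, continuous (fun t => Derive (fun s' => w s' t ^ 2) s) t).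
    { intros t.
      apply (continuous_ext (fun t => 2 * w s t *
        (- (1 / 2) * Derive (Derive (Derive (w s))) t + u s t * Derive (w s) t))).
      - intros x. symmetry. now apply dqE.
      - apply differentiable_continuous. auto_derive.
        repeat split; try (now apply smooth_fn_ex_derive); now apply du. }
    assert (id : ex_RInt (fun t => Derive (fun s' => w s' t ^ 2) s) l r).
    { apply (ex_RInt_continuous (V := R_CompleteNormedModule)). auto. }
    assert (total : is_RInt (fun t => Derive (fun s' => w s' t ^ 2) s
                + Derive (u s) t * w s t ^ 2) l r 0).
    { rewrite <- (Rminus_diag_eq _ _ ePhi).
      apply (is_RInt_derive (V := R_CompleteNormedModule) Phi); [auto|]. intros x _.
      apply (continuous_plus (fun t => Derive (fun s' => w s' t ^ 2) s)
        (fun t => Derive (u s) t * w s t ^ 2) x); auto. }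
    apply (is_RInt_unique (V := R_CompleteNormedModule)) in total.
    assert (split : RInt (fun t => Derive (fun s' => w s' t ^ 2) s
                + Derive (u s) t * w s t ^ 2) l r
      = RInt (fun t => Derive (fun s' => w s' t ^ 2) s) l r
        + RInt (fun t => Derive (u s) t * w s t ^ 2) l r).
    { apply (RInt_plus (V := R_CompleteNormedModule)); auto. }
    rewrite total in split. lra. }
  assert (dE : forall s, in_open_interval a b s ->
    is_derive (fun s => RInt (fun t => w s t ^ 2) l r) s
      (- RInt (fun t => Derive (u s) t * w s t ^ 2) l r)).
  { intros s hs. rewrite <- flux by exact hs.
    apply (is_derive_RInt_param (fun s t => w s t ^ 2)).
    - apply (filter_imp (in_open_interval a b)); [|now apply open_strip].
      intros y hy t _. eexists. exact (dq y t hy).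
    - intros t _.
      apply (continuity_2d_pt_ext_loc
        (fun s t => 2 * (w s t * Derive (fun s' => w s' t) s))).
      + apply (open_strip_2d a b); [|exact hs]. intros x y hx.
        rewrite dqE, evolE by exact hx. ring.
      + apply continuity_2d_pt_mult; [apply continuity_2d_pt_const|].
        apply continuity_2d_pt_mult; auto.
    - apply (filter_imp (in_open_interval a b)); [|now apply open_strip]. auto. }
  apply (RInt_square_zero (w s1) l r).
  - intros x. apply differentiable_continuous.
    now apply smooth_fn_ex_derive, sw.
  - unfold l, r; lra.
  - apply (gronwall_zero (fun s => RInt (fun t => w s t ^ 2) l r) _ K s0 s1
      (fun s hs => dE s (inside s hs))).
    + intros s hs. pose proof (inside s hs) as hs'. rewrite Rabs_Ropp.
      apply (Rle_trans _ (RInt (fun t => Rabs (Derive (u s) t * w s t ^ 2)) l r)).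
      * apply abs_RInt_le; auto.
      * assert (e : RInt (fun t => K * w s t ^ 2) l r
                    = K * RInt (fun t => w s t ^ 2) l r)
          by (apply (RInt_scal (V := R_CompleteNormedModule)); auto).
        rewrite <- e. apply RInt_le; [exact lr'| | |].
        -- apply (ex_RInt_norm (fun t => Derive (u s) t * w s t ^ 2)). auto.
        -- apply (ex_RInt_scal (V := R_NormedModule)). auto.
        -- intros x hx. rewrite Rabs_mult, (Rabs_pos_eq (w s x ^ 2)) by apply pow2_ge_0.
           apply Rmult_le_compat_r; [apply pow2_ge_0|]. apply hK; lra.
    + rewrite (RInt_ext _ (fun _ => 0)).
      * rewrite RInt_const. apply Rmult_0_r.
      * intros x _. rewrite init. exact (Rmult_0_l _).
Qed.

(** * The Lax pair of KdV *)

(** Joint smoothness serves the exchange of partial derivatives and the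
    differentiation of integrals in s; smoothness in t alone carries the
    calculations at a fixed time. *)
Record lax_solution (a b : Rbar) (p phi : R -> R -> R) : Prop := {
  lax_joint : forall n s t, in_open_interval a b s -> ex_diff_n phi n s t;
  lax_smooth : forall s, in_open_interval a b s -> smooth_fn (phi s);
  lax_space : forall s t, in_open_interval a b s ->
    Derive (Derive (phi s)) t = p s t * phi s t;
  lax_time : forall s t, in_open_interval a b s ->
    is_derive (fun s' => phi s' t) s
      (- (1 / 2) * Derive (p s) t * phi s t + p s t * Derive (phi s) t)
}.
Arguments lax_joint {a b p phi}.
Arguments lax_smooth {a b p phi}.
Arguments lax_space {a b p phi}.
Arguments lax_time {a b p phi}.

Lemma lax_derive (a b : Rbar) (p phi : R -> R -> R) (s t : R) :
  lax_solution a b p phi -> in_open_interval a b s ->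
  is_derive (phi s) t (Derive (phi s) t).
Proof. intros L hs. apply Derive_correct, smooth_fn_ex_derive, (lax_smooth L s hs). Qed.

Lemma lax_derive2 (a b : Rbar) (p phi : R -> R -> R) (s t : R) :
  lax_solution a b p phi -> in_open_interval a b s ->
  is_derive (Derive (phi s)) t (p s t * phi s t).
Proof.
  intros L hs. rewrite <- (lax_space L s t hs).
  apply Derive_correct, smooth_fn_ex_derive, smooth_fn_Derive, (lax_smooth L s hs).
Qed.

(** These formulas, with phi' psi' as the remaining unknown, are used both for
    the evolution of determinants and, at a fixed time, for Miura's relation. *)
Lemma lax_product_derive2 (a b : Rbar) (p q phi psi : R -> R -> R) (s t : R) :
  lax_solution a b p phi -> lax_solution a b q psi -> in_open_interval a b s ->
  Derive (fun t => phi s t * psi s t) t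
    = Derive (phi s) t * psi s t + phi s t * Derive (psi s) t /\
  Derive (Derive (fun t => phi s t * psi s t)) t
    = (p s t + q s t) * (phi s t * psi s t)
      + 2 * (Derive (phi s) t * Derive (psi s) t).
Proof.
  intros L M hs.
  assert (d1 : forall t, Derive (fun t => phi s t * psi s t) t
    = Derive (phi s) t * psi s t + phi s t * Derive (psi s) t).
  { intros x. apply is_derive_unique, derive_mult;
    [exact (lax_derive a b p phi s x L hs) | exact (lax_derive a b q psi s x M hs)]. }
  split; [apply d1|]. rewrite (Derive_ext _ _ _ d1). apply is_derive_unique.
  apply (is_derive_eq _ _
    ((p s t * phi s t * psi s t + Derive (phi s) t * Derive (psi s) t)
     + (Derive (phi s) t * Derive (psi s) t + phi s t * (q s t * psi s t))));
    [| ring].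
  apply (derive_plus (fun x => Derive (phi s) x * psi s x)
                        (fun x => phi s x * Derive (psi s) x));
  apply derive_mult;
  try exact (lax_derive a b _ _ s t L hs); try exact (lax_derive a b _ _ s t M hs);
  try exact (lax_derive2 a b _ _ s t L hs); exact (lax_derive2 a b _ _ s t M hs).
Qed.

(** Both sides are combinations of phi psi, phi' psi and phi psi':
    the third derivative contains (p' + q') phi psi and the crossed terms
    2 (p phi psi' + q phi' psi), whereas the flow produces the straight terms
    p phi' psi + q phi psi'. Adding (3/2) (p + q) (phi psi)' exchanges crossed
    for straight. Only p + q enters, symmetrically, so the equation is the same
    for both products in a determinant. *)
Lemma lax_product_evolution (a b : Rbar) (p q phi psi : R -> R -> R) (s t : R) :
  lax_solution a b p phi -> lax_solution a b q psi -> in_open_interval a b s ->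
  ex_derive (p s) t -> ex_derive (q s) t ->
  is_derive (fun s' => phi s' t * psi s' t) s
    (- (1 / 2) * Derive_n (fun t => phi s t * psi s t) 3 t
     + 3 / 2 * (p s t + q s t) * Derive (fun t => phi s t * psi s t) t).
Proof.
  intros L M hs dp dq.
  assert (d3 : Derive_n (fun t => phi s t * psi s t) 3 t
    = (Derive (p s) t + Derive (q s) t) * (phi s t * psi s t)
      + (p s t + q s t) * (Derive (phi s) t * psi s t + phi s t * Derive (psi s) t)
      + 2 * (p s t * phi s t * Derive (psi s) t
             + Derive (phi s) t * (q s t * psi s t))).
  { transitivity (Derive (Derive (Derive (fun t => phi s t * psi s t))) t);
      [reflexivity|].
    rewrite (Derive_ext _ (fun t => (p s t + q s t) * (phi s t * psi s t)
      + 2 * (Derive (phi s) t * Derive (psi s) t)))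
      by (intros x; apply (lax_product_derive2 a b p q phi psi s x L M hs)).
    apply is_derive_unique.
    apply (derive_plus (fun t => (p s t + q s t) * (phi s t * psi s t))
                          (fun t => 2 * (Derive (phi s) t * Derive (psi s) t))).
    - apply (derive_mult (fun t => p s t + q s t) (fun t => phi s t * psi s t)).
      + apply (derive_plus (p s) (q s)); now apply Derive_correct.
      + apply derive_mult; [exact (lax_derive a b _ _ s t L hs)
                           | exact (lax_derive a b _ _ s t M hs)].
    - apply is_derive_scal, derive_mult; [exact (lax_derive2 a b _ _ s t L hs)
                           | exact (lax_derive2 a b _ _ s t M hs)]. }
  rewrite d3. destruct (lax_product_derive2 a b p q phi psi s t L M hs) as [-> _].
  apply (is_derive_eq _ _
    ((- (1 / 2) * Derive (p s) t * phi s t + p s t * Derive (phi s) t) * psi s t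
     + phi s t * (- (1 / 2) * Derive (q s) t * psi s t + q s t * Derive (psi s) t)));
    [| field].
  apply (derive_mult (fun s' => phi s' t) (fun s' => psi s' t));
    [exact (lax_time L s t hs) | exact (lax_time M s t hs)].
Qed.

(** The t-derivative of the second equation of the Lax pair, simplified with the
    first; the exchange of partial derivatives is Schwarz's theorem. *)
Lemma lax_time_derive (a b : Rbar) (p phi : R -> R -> R) (s t : R) :
  lax_solution a b p phi -> in_open_interval a b s -> smooth_fn (p s) ->
  is_derive (fun s' => Derive (phi s') t) s
    ((- (1 / 2) * Derive (Derive (p s)) t + p s t ^ 2) * phi s t
     + 1 / 2 * Derive (p s) t * Derive (phi s) t).
Proof.
  intros L hs sp.
  assert (J := fun s t hs => lax_joint L 2%nat s t hs).
  assert (ex : ex_derive (fun s' => Derive (phi s') t) s)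
    by exact (proj1 (proj2 (proj2 (proj2 (proj2 (proj2 (J s t hs))))))).
  assert (sch : Derive (fun s' => Derive (phi s') t) s
    = Derive (fun t' => Derive (fun s' => phi s' t') s) t).
  { apply Schwarz.
    - apply (open_strip_2d a b); [|exact hs]. intros x y hx.
      destruct (J x y hx) as [_ [h1 [h2 [h3 h4]]]].
      exact (conj h1 (conj h2 (conj (proj1 (proj2 h4)) (proj1 (proj2 (proj2 h3)))))).
    - apply (J s t hs).
    - apply (J s t hs). }
  assert (e : Derive (fun s' => Derive (phi s') t) s
    = (- (1 / 2) * Derive (Derive (p s)) t + p s t ^ 2) * phi s t
     + 1 / 2 * Derive (p s) t * Derive (phi s) t).
  { rewrite sch.
    rewrite (Derive_ext _ (fun t => - (1 / 2) * Derive (p s) t * phi s t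
      + p s t * Derive (phi s) t))
      by (intros x; exact (is_derive_unique _ _ _ (lax_time L s x hs))).
    apply is_derive_unique.
    apply (is_derive_eq _ _
      ((- (1 / 2) * Derive (Derive (p s)) t) * phi s t
       + - (1 / 2) * Derive (p s) t * Derive (phi s) t
       + (Derive (p s) t * Derive (phi s) t + p s t * (p s t * phi s t))));
    [| field].
    apply (derive_plus (fun t => - (1 / 2) * Derive (p s) t * phi s t)
                          (fun t => p s t * Derive (phi s) t)).
    - apply (derive_mult (fun t => - (1 / 2) * Derive (p s) t) (phi s));
        [|exact (lax_derive a b _ _ s t L hs)].
      apply is_derive_scal, Derive_correct, smooth_fn_ex_derive, smooth_fn_Derive, sp.
    - apply (derive_mult (p s) (Derive (phi s)));
        [|exact (lax_derive2 a b _ _ s t L hs)].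
      apply Derive_correct, smooth_fn_ex_derive, sp. }
  rewrite <- e. now apply Derive_correct.
Qed.

(** * From the flow of curves to Lax pairs *)

(** The flow written in the components x, y of the curve. The curvatures at the
    different times form one function p of both variables, so that joint
    continuity of p' makes sense: the energy estimate needs it. *)
Record kdv_curve (a b : Rbar) (p x y : R -> R -> R) : Prop := {
  kdv_x : lax_solution a b p x;
  kdv_y : lax_solution a b p y;
  kdv_wronskian : forall s t, in_open_interval a b s ->
    x s t * Derive (y s) t - Derive (x s) t * y s t = 1;
  kdv_antiperiodic : forall s t, in_open_interval a b s ->
    x s (t + PI) = - x s t /\ y s (t + PI) = - y s t;
  kdv_p_smooth : forall s, in_open_interval a b s -> smooth_fn (p s);
  kdv_p_periodic : forall s t, in_open_interval a b s -> p s (t + PI) = p s t;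
  kdv_p_continuous : forall s t, in_open_interval a b s ->
    continuity_2d_pt (fun s t => Derive (p s) t) s t
}.

Lemma is_derive_pair (g : R -> R * R) (s : R) (l : R * R) :
  is_derive g s l ->
  is_derive (fun s => fst (g s)) s (fst l) /\ is_derive (fun s => snd (g s)) s (snd l).
Proof.
  intros d. split.
  - exact (filterdiff_comp' g (fun z : R * R => fst z) s _ (fun z : R * R => fst z) d
      (filterdiff_linear _ is_linear_fst)).
  - exact (filterdiff_comp' g (fun z : R * R => snd z) s _ (fun z : R * R => snd z) d
      (filterdiff_linear _ is_linear_snd)).
Qed.

Lemma continuity_Derive_n (phi : R -> R -> R) (n : nat) (s t : R) :
  ex_diff_n phi n s t -> continuity_2d_pt (fun s t => Derive_n (phi s) n t) s t.
Proof.
  intros J. generalize (ex_diff_n_deriv n 0 n (le_n n) phi s t J).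
  destruct (n - (0 + n))%nat; intros [h _]; exact h.
Qed.

Lemma kdv_flow_components (a b : Rbar) (g : R -> R -> R * R) :
  kdv_flow a b g ->
  exists p, kdv_curve a b p (fun s t => fst (g s t)) (fun s t => snd (g s t)).
Proof.
  intros [J H].
  set (x := fun s t => fst (g s t)). set (y := fun s t => snd (g s t)).
  assert (sx : forall s, in_open_interval a b s -> smooth_fn (x s))
    by (intros s hs n t; apply (H s hs)).
  assert (sy : forall s, in_open_interval a b s -> smooth_fn (y s))
    by (intros s hs n t; apply (H s hs)).
  set (p := fun s t => Derive (Derive (x s)) t * Derive (y s) t
                       - Derive (Derive (y s)) t * Derive (x s) t).
  assert (w : forall s t, in_open_interval a b s ->
    x s t * Derive (y s) t - Derive (x s) t * y s t = 1)
    by (intros s t hs; apply (H s hs)).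
  (* From g'' = k g and [g,g'] = 1 one gets k = [g'',g'], so that the curvature
     inherits smoothness from the curve. *)
  assert (curv : forall s, in_open_interval a b s ->
    exists k, is_curvature (g s) k /\ (forall t, k t = p s t) /\
      forall t, is_derive (fun s' => g s' t) s
          (plus (scal (- (1 / 2) * Derive k t) (g s t))
                (scal (k t) (curve_deriv (g s) t)))).
  { intros s hs. destruct (H s hs) as [_ [k [[h1 h2] h3]]].
    exists k. split; [now split|]. split; [|exact h3]. intros t. unfold p.
    generalize (f_equal fst (h2 t)) (f_equal snd (h2 t)).
    intros e1 e2.
    change (Derive (Derive (x s)) t = k t * x s t) in e1.
    change (Derive (Derive (y s)) t = k t * y s t) in e2.
    rewrite e1, e2. rewrite <- (Rmult_1_r (k t)) at 1. rewrite <- (w s t hs). ring. }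
  assert (sp : forall s, in_open_interval a b s -> smooth_fn (p s)).
  { intros s hs. apply smooth_fn_minus; apply smooth_fn_mult; auto using smooth_fn_Derive. }
  assert (space : forall s t, in_open_interval a b s ->
    Derive (Derive (x s)) t = p s t * x s t /\
    Derive (Derive (y s)) t = p s t * y s t).
  { intros s t hs. destruct (curv s hs) as [k [[_ h2] [e _]]]. rewrite <- e.
    exact (conj (f_equal fst (h2 t)) (f_equal snd (h2 t))). }
  assert (time : forall s t, in_open_interval a b s ->
    is_derive (fun s' => x s' t) s
      (- (1 / 2) * Derive (p s) t * x s t + p s t * Derive (x s) t) /\
    is_derive (fun s' => y s' t) s
      (- (1 / 2) * Derive (p s) t * y s t + p s t * Derive (y s) t)).
  { intros s t hs. destruct (curv s hs) as [k [_ [e d]]].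
    rewrite <- e, <- (Derive_ext _ _ _ e). exact (is_derive_pair _ _ _ (d t)). }
  exists p. split.
  - split; auto; intros s t hs; try apply (space s t hs); try apply (time s t hs).
    intros ht. apply (J s t hs ht).
  - split; auto; intros s t hs; try apply (space s t hs); try apply (time s t hs).
    intros ht. apply (J s t hs ht).
  - exact w.
  - intros s t hs. destruct (H s hs) as [[_ [_ anti]] _].
    exact (conj (f_equal fst (anti t)) (f_equal snd (anti t))).
  - exact sp.
  - intros s t hs. destruct (curv s hs) as [k [[per _] [e _]]].
    now rewrite <- !e.
  - intros s t hs.
    (* p' = [g''',g'], the term [g'',g''] being zero *)
    apply (continuity_2d_pt_ext_loc (fun s t =>
      Derive_n (x s) 3 t * Derive_n (y s) 1 t
      - Derive_n (y s) 3 t * Derive_n (x s) 1 t)).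
    + apply (open_strip_2d a b); [|exact hs]. clear s t hs. intros s t hs.
      symmetry. apply is_derive_unique.
      assert (dd : forall h n, smooth_fn h ->
        is_derive (Derive_n h n) t (Derive_n h (S n) t))
        by (intros h n sh; apply Derive_correct; exact (sh (S n) t)).
      apply (is_derive_eq _ _
        ((Derive_n (x s) 3 t * Derive (y s) t
          + Derive (Derive (x s)) t * Derive (Derive (y s)) t)
         - (Derive_n (y s) 3 t * Derive (x s) t
            + Derive (Derive (y s)) t * Derive (Derive (x s)) t)));
        [|change (Derive_n (x s) 1 t) with (Derive (x s) t);
          change (Derive_n (y s) 1 t) with (Derive (y s) t); ring].
      apply derive_minus; apply derive_mult.
      * exact (dd _ 2%nat (sx s hs)).
      * exact (dd _ 1%nat (sy s hs)).
      * exact (dd _ 2%nat (sy s hs)).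
      * exact (dd _ 1%nat (sx s hs)).
    + apply continuity_2d_pt_minus; apply continuity_2d_pt_mult;
      apply continuity_Derive_n, (J _ s t hs).
Qed.

(** * Persistence of c-relatedness *)

(** The difference [gamma,delta] - c solves the linear equation satisfied by
    products of Lax solutions, with zero initial value. *)
Lemma kdv_det_constant (a b : Rbar) (s0 c : R) (p x y q v w : R -> R -> R) :
  kdv_curve a b p x y -> kdv_curve a b q v w ->
  in_open_interval a b s0 ->
  (forall t, x s0 t * w s0 t - v s0 t * y s0 t = c) ->
  forall s t, in_open_interval a b s -> x s t * w s t - v s t * y s t = c.
Proof.
  intros G D hs0 init s t hs. apply Rminus_diag_uniq.
  assert (sp := kdv_p_smooth _ _ _ _ _ G). assert (sq := kdv_p_smooth _ _ _ _ _ D).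
  destruct G as [Lx Ly _ anti _ pp cp]. destruct D as [Lv Lw _ anti' _ pq cq].
  assert (sxw : forall s, in_open_interval a b s -> smooth_fn (fun t => x s t * w s t)).
  { intros r hr. apply smooth_fn_mult;
    [exact (lax_smooth Lx r hr) | exact (lax_smooth Lw r hr)]. }
  assert (svy : forall s, in_open_interval a b s -> smooth_fn (fun t => v s t * y s t)).
  { intros r hr. apply smooth_fn_mult;
    [exact (lax_smooth Lv r hr) | exact (lax_smooth Ly r hr)]. }
  assert (du : forall s t, in_open_interval a b s ->
    is_derive (fun t => 3 / 2 * (p s t + q s t)) t
      (3 / 2 * (Derive (p s) t + Derive (q s) t))).
  { intros r z hr. apply is_derive_scal, (derive_plus (p r) (q r));
    apply Derive_correct, smooth_fn_ex_derive; auto. }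
  assert (evol : forall s t, in_open_interval a b s ->
    is_derive (fun s' => x s' t * w s' t - v s' t * y s' t - c) s
      (- (1 / 2) * Derive_n (fun t => x s t * w s t - v s t * y s t - c) 3 t
       + 3 / 2 * (p s t + q s t)
         * Derive (fun t => x s t * w s t - v s t * y s t - c) t)).
  { intros r z hr.
    assert (ep := smooth_fn_ex_derive _ z (sp r hr)).
    assert (eq := smooth_fn_ex_derive _ z (sq r hr)).
    assert (lin : forall n, Derive_n (fun t => x r t * w r t - v r t * y r t - c) (S n) z
      = Derive_n (fun t => x r t * w r t) (S n) z - Derive_n (fun t => v r t * y r t) (S n) z).
    { intros n. rewrite (Derive_n_minus _ (fun _ => c)), Derive_n_const;
        [|apply filter_forall; intros; apply smooth_fn_minus; auto
         |apply filter_forall; intros; apply ex_derive_n_const].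
      rewrite Rminus_0_r. apply Derive_n_minus; apply filter_forall; intros.
      - now apply sxw.
      - now apply svy. }
    assert (lin1 := lin 0%nat). rewrite (lin 2%nat).
    change (Derive (fun t => x r t * w r t - v r t * y r t - c) z
      = Derive (fun t => x r t * w r t) z - Derive (fun t => v r t * y r t) z) in lin1.
    rewrite lin1.
    assert (e1 := lax_product_evolution a b p q x w r z Lx Lw hr ep eq).
    assert (e2 := lax_product_evolution a b q p v y r z Lv Ly hr eq ep).
    refine (is_derive_eq _ _ _ _ (derive_minus _ _ _ _ _
      (derive_minus _ _ _ _ _ e1 e2) (derive_const c r)) _).
    ring. }
  assert (regular : forall phi, (forall n s t, in_open_interval a b s -> ex_diff_n phi n s t) ->
    forall s t, in_open_interval a b s -> continuity_2d_pt phi s t /\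
      ex_derive (fun s => phi s t) s /\
      continuity_2d_pt (fun s t => Derive (fun s' => phi s' t) s) s t).
  { intros phi J r z hr. destruct (J 1%nat r z hr) as [h0 [h1 [_ [[h2 _] _]]]]. now split. }
  assert (jx := regular x (lax_joint Lx)). assert (jy := regular y (lax_joint Ly)).
  assert (jv := regular v (lax_joint Lv)). assert (jw := regular w (lax_joint Lw)).
  apply (dispersive_zero a b s0 (fun s t => x s t * w s t - v s t * y s t - c)
    (fun s t => 3 / 2 * (p s t + q s t))); try assumption.
  - intros r hr. apply smooth_fn_minus; [apply smooth_fn_minus; auto|].
    intros n z. apply ex_derive_n_const.
  - intros r z hr. destruct (anti r z hr) as [-> ->]. destruct (anti' r z hr) as [-> ->].
    ring.
  - intros r z hr. rewrite pp, pq; auto.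
  - intros r z hr. eexists. exact (du r z hr).
  - intros r z hr. apply (continuity_2d_pt_ext_loc
      (fun s t => 3 / 2 * (Derive (p s) t + Derive (q s) t))).
    + apply (open_strip_2d a b); [|exact hr]. intros r' z' hr'.
      symmetry. exact (is_derive_unique _ _ _ (du r' z' hr')).
    + apply continuity_2d_pt_mult; [apply continuity_2d_pt_const|].
      apply continuity_2d_pt_plus; auto.
  - intros r z hr. apply continuity_2d_pt_minus; [|apply continuity_2d_pt_const].
    apply continuity_2d_pt_minus; apply continuity_2d_pt_mult;
    [apply jx | apply jw | apply jv | apply jy]; assumption.
  - intros r z hr. apply (continuity_2d_pt_ext_loc (fun s t =>
      (Derive (fun s' => x s' t) s * w s t + x s t * Derive (fun s' => w s' t) s)
      - (Derive (fun s' => v s' t) s * y s t + v s t * Derive (fun s' => y s' t) s))).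
    + apply (open_strip_2d a b); [|exact hr]. intros r' z' hr'.
      symmetry. apply is_derive_unique.
      refine (is_derive_eq _ _ _ _ (derive_minus _ _ _ _ _ (derive_minus _ _ _ _ _
        (derive_mult _ _ _ _ _ (Derive_correct _ _ (proj1 (proj2 (jx r' z' hr'))))
                               (Derive_correct _ _ (proj1 (proj2 (jw r' z' hr')))))
        (derive_mult _ _ _ _ _ (Derive_correct _ _ (proj1 (proj2 (jv r' z' hr'))))
                               (Derive_correct _ _ (proj1 (proj2 (jy r' z' hr'))))))
        (derive_const c r')) _).
      apply Rminus_0_r.
    + apply continuity_2d_pt_minus; apply continuity_2d_pt_plus;
      apply continuity_2d_pt_mult;
      solve [apply jx; assumption | apply jw; assumption
            | apply jv; assumption | apply jy; assumption].
  - intros z. rewrite init. apply Rminus_diag.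
Qed.

(** * The Miura transformation and mKdV *)

(** Here f = [delta,gamma']. The last formula, for [delta',gamma'], comes from
    [gamma,delta]'' = 0 = (p + q) c + 2 [gamma',delta']; it yields f' directly,
    and f^2 - 1 through Pluecker's relation. Equivalently,
    c^2 p = f^2 - 1 - c f' and c^2 q = f^2 - 1 + c f'. *)
Lemma miura (a b : Rbar) (s c : R) (p x y q v w : R -> R -> R) :
  kdv_curve a b p x y -> kdv_curve a b q v w -> in_open_interval a b s ->
  (forall t, x s t * w s t - v s t * y s t = c) ->
  forall t,
    is_derive (fun t => v s t * Derive (y s) t - w s t * Derive (x s) t) t
      (c / 2 * (q s t - p s t)) /\
    (v s t * Derive (y s) t - w s t * Derive (x s) t) ^ 2 - 1
      = c ^ 2 / 2 * (p s t + q s t) /\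
    Derive (v s) t * Derive (y s) t - Derive (w s) t * Derive (x s) t
      = c / 2 * (p s t + q s t).
Proof.
  intros G D hs hc t.
  assert (wG := kdv_wronskian _ _ _ _ _ G s t hs).
  assert (wD := kdv_wronskian _ _ _ _ _ D s t hs).
  destruct G as [Lx Ly _ _ _ _ _]. destruct D as [Lv Lw _ _ _ _ _].
  assert (sxw : smooth_fn (fun t => x s t * w s t))
    by exact (smooth_fn_mult _ _ (lax_smooth Lx s hs) (lax_smooth Lw s hs)).
  assert (svy : smooth_fn (fun t => v s t * y s t))
    by exact (smooth_fn_mult _ _ (lax_smooth Lv s hs) (lax_smooth Ly s hs)).
  assert (e1 : forall t, Derive (fun t => x s t * w s t) t
               = Derive (fun t => v s t * y s t) t).
  { intros z. apply Rminus_diag_uniq.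
    rewrite <- (Derive_const c z), <- (Derive_ext _ _ z hc).
    symmetry. apply Derive_minus; now apply smooth_fn_ex_derive. }
  assert (e2 := Derive_ext _ _ t e1).
  specialize (e1 t).
  destruct (lax_product_derive2 a b p q x w s t Lx Lw hs) as [xw1 xw2].
  destruct (lax_product_derive2 a b q p v y s t Lv Ly hs) as [vy1 vy2].
  rewrite xw1, vy1 in e1. rewrite xw2, vy2 in e2. specialize (hc t).
  assert (C : Derive (v s) t * Derive (y s) t - Derive (w s) t * Derive (x s) t
      = c / 2 * (p s t + q s t)) by (rewrite <- hc; lra).
  split; [|split; [|exact C]].
  - refine (is_derive_eq _ _ _ _ (derive_minus _ _ _ _ _
      (derive_mult _ _ _ _ _ (lax_derive a b q v s t Lv hs) (lax_derive2 a b p y s t Ly hs))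
      (derive_mult _ _ _ _ _ (lax_derive a b q w s t Lw hs) (lax_derive2 a b p x s t Lx hs))) _).
    replace (c / 2 * (q s t - p s t)) with (c / 2 * (p s t + q s t) - p s t * c) by field.
    rewrite <- C, <- hc. ring.
  - replace (c ^ 2 / 2 * (p s t + q s t)) with (c * (c / 2 * (p s t + q s t))) by field.
    rewrite <- C, <- hc at 1.
    (* Pluecker's relation
         [g,d'] [d,g'] - [g,d] [d',g'] = [g,g'] [d,d']
       for g = gamma and d = delta, where [g,d'] = [d,g'] because [g,d] is
       constant. *)
    assert (wwE : 1 = (x s t * Derive (y s) t - Derive (x s) t * y s t)
      * (v s t * Derive (w s) t - Derive (v s) t * w s t)) by (rewrite wG, wD; ring).
    assert (f2 : v s t * Derive (y s) t - w s t * Derive (x s) t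
      = x s t * Derive (w s) t - Derive (v s) t * y s t) by lra.
    replace ((v s t * Derive (y s) t - w s t * Derive (x s) t) ^ 2)
      with ((v s t * Derive (y s) t - w s t * Derive (x s) t)
            * (x s t * Derive (w s) t - Derive (v s) t * y s t))
      by (rewrite <- f2; ring).
    rewrite wwE. ring.
Qed.

(** The Lax pairs give
      f_s = (p' - q') f / 2 + (c/2) q (p + q) + c p'' / 2 - c p^2,
    and the claim reduces, through Miura's relations, to an identity in p, q, f
    and their derivatives. *)
Lemma coefficient_mkdv (a b : Rbar) (c : R) (p x y q v w : R -> R -> R) :
  c <> 0 -> kdv_curve a b p x y -> kdv_curve a b q v w ->
  (forall s t, in_open_interval a b s -> x s t * w s t - v s t * y s t = c) ->
  forall s t, in_open_interval a b s ->
    let f := fun s t => v s t * Derive (y s) t - w s t * Derive (x s) t in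
    is_derive (fun s => f s t) s
      (- (1 / 2) * Derive_n (f s) 3 t
       + 3 / c ^ 2 * (f s t ^ 2 - 1) * Derive (f s) t).
Proof.
  intros c0 G D hc s t hs f.
  assert (M := miura a b s c p x y q v w G D hs (fun t => hc s t hs)).
  assert (sp := kdv_p_smooth _ _ _ _ _ G s hs).
  assert (sq := kdv_p_smooth _ _ _ _ _ D s hs).
  assert (sp' := smooth_fn_Derive _ sp). assert (sq' := smooth_fn_Derive _ sq).
  assert (dp := fun t => Derive_correct _ t (smooth_fn_ex_derive _ t sp)).
  assert (dq := fun t => Derive_correct _ t (smooth_fn_ex_derive _ t sq)).
  assert (dp' := fun t => Derive_correct _ t (smooth_fn_ex_derive _ t sp')).
  assert (dq' := fun t => Derive_correct _ t (smooth_fn_ex_derive _ t sq')).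
  assert (df : forall t, is_derive (f s) t (c / 2 * (q s t - p s t)))
    by (intros z; apply (M z)).
  assert (df1 : forall t, is_derive (fun t => c / 2 * (q s t - p s t)) t
    (c / 2 * (Derive (q s) t - Derive (p s) t))).
  { intros z. apply is_derive_scal, (derive_minus (q s) (p s)); auto. }
  assert (df2 : forall t, is_derive (fun t => c / 2 * (Derive (q s) t - Derive (p s) t)) t
    (c / 2 * (Derive (Derive (q s)) t - Derive (Derive (p s)) t))).
  { intros z. apply is_derive_scal, (derive_minus (Derive (q s)) (Derive (p s))); auto. }
  assert (f1 : forall t, Derive (f s) t = c / 2 * (q s t - p s t))
    by (intros z; exact (is_derive_unique _ _ _ (df z))).
  assert (f2 : forall t, Derive (Derive (f s)) t
    = c / 2 * (Derive (q s) t - Derive (p s) t))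
    by (intros z; rewrite (Derive_ext _ _ z f1); exact (is_derive_unique _ _ _ (df1 z))).
  assert (f3 : Derive_n (f s) 3 t
    = c / 2 * (Derive (Derive (q s)) t - Derive (Derive (p s)) t)).
  { transitivity (Derive (Derive (Derive (f s))) t); [reflexivity|].
    rewrite (Derive_ext _ _ t f2). exact (is_derive_unique _ _ _ (df2 t)). }
  (* The evolution of f computed from the Lax pairs contains p'' + q'', which
     Miura's relation, differentiated twice, expresses through f. *)
  assert (m1 : forall t, 2 * f s t * (c / 2 * (q s t - p s t))
    = c ^ 2 / 2 * (Derive (p s) t + Derive (q s) t)).
  { intros z.
    assert (l : is_derive (fun t => f s t * f s t - 1) z
      (c ^ 2 / 2 * (Derive (p s) z + Derive (q s) z))).
    { apply (is_derive_ext (fun t => c ^ 2 / 2 * (p s t + q s t))).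
      - intros r. enough (e : c ^ 2 / 2 * (p s r + q s r) = f s r * f s r - 1) by exact e.
        rewrite <- (proj1 (proj2 (M r))). unfold f. ring.
      - apply is_derive_scal, (derive_plus (p s) (q s)); auto. }
    assert (r := derive_minus _ _ _ _ _ (derive_mult _ _ _ _ _ (df z) (df z))
      (derive_const 1 z)).
    assert (e := eq_trans (eq_sym (is_derive_unique _ _ _ r)) (is_derive_unique _ _ _ l)).
    rewrite <- e. ring. }
  assert (m2 : 2 * (c / 2 * (q s t - p s t)) ^ 2
      + 2 * f s t * (c / 2 * (Derive (q s) t - Derive (p s) t))
    = c ^ 2 / 2 * (Derive (Derive (p s)) t + Derive (Derive (q s)) t)).
  { assert (l : is_derive (fun t => f s t * (c / 2 * (q s t - p s t))) t
      (c ^ 2 / 4 * (Derive (Derive (p s)) t + Derive (Derive (q s)) t))).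
    { apply (is_derive_ext (fun t => c ^ 2 / 4 * (Derive (p s) t + Derive (q s) t))).
      - intros r. generalize (m1 r). lra.
      - apply is_derive_scal, (derive_plus (Derive (p s)) (Derive (q s))); auto. }
    assert (r := derive_mult _ _ _ _ _ (df t) (df1 t)).
    assert (e := eq_trans (eq_sym (is_derive_unique _ _ _ r)) (is_derive_unique _ _ _ l)).
    lra. }
  destruct (M t) as [_ [m0 C]]. specialize (hc s t hs).
  rewrite f3, f1.
  destruct G as [Lx Ly _ _ _ _ _]. destruct D as [Lv Lw _ _ _ _ _].
  refine (is_derive_eq _ _ _ _ (derive_minus _ _ _ _ _
    (derive_mult _ _ _ _ _ (lax_time Lv s t hs) (lax_time_derive a b p y s t Ly hs sp))
    (derive_mult _ _ _ _ _ (lax_time Lw s t hs) (lax_time_derive a b p x s t Lx hs sp))) _).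
  transitivity ((- (1 / 2) * Derive (q s) t + 1 / 2 * Derive (p s) t) * f s t
    + q s t * (c / 2 * (p s t + q s t))
    - (- (1 / 2) * Derive (Derive (p s)) t + p s t ^ 2) * c).
  - rewrite <- C, <- hc. unfold f. ring.
  - change (f s t ^ 2 - 1 = c ^ 2 / 2 * (p s t + q s t)) in m0.
    rewrite m0.
    replace (3 / c ^ 2 * (c ^ 2 / 2 * (p s t + q s t))) with (3 / 2 * (p s t + q s t))
      by (now field).
    apply (Rmult_eq_reg_l c); [|exact c0].
    nra.
Qed.

Theorem theorem1 (c : R) (hc : c <> 0) (a b : Rbar) (s0 : R)
  (hs0 : in_open_interval a b s0)
  (gamma delta : R -> R -> R * R) (f0 : R -> R)
  (hgamma : kdv_flow a b gamma) (hdelta : kdv_flow a b delta)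
  (hrel : c_related c (gamma s0) (delta s0))
  (hf0 : is_coefficient c (gamma s0) (delta s0) f0) :
  (forall s, in_open_interval a b s -> c_related c (gamma s) (delta s)) /\
  (exists f : R -> R -> R, forall s, in_open_interval a b s ->
     is_coefficient c (gamma s) (delta s) (f s)) /\
  (forall f : R -> R -> R,
     (forall s, in_open_interval a b s ->
        is_coefficient c (gamma s) (delta s) (f s)) ->
     (forall t, f s0 t = f0 t) /\
     forall s t, in_open_interval a b s ->
       ex_derive_n (f s) 3 t /\
       is_derive (fun s' => f s' t) s
         (- (1 / 2) * Derive_n (f s) 3 t
          + 3 / c ^ 2 * ((f s t) ^ 2 - 1) * Derive (f s) t)).
Proof.
  destruct (kdv_flow_components a b gamma hgamma) as [p G].
  destruct (kdv_flow_components a b delta hdelta) as [q D].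
  set (x := fun s t => fst (gamma s t)) in G. set (y := fun s t => snd (gamma s t)) in G.
  set (v := fun s t => fst (delta s t)) in D. set (w := fun s t => snd (delta s t)) in D.
  assert (rel := kdv_det_constant a b s0 c p x y q v w G D hs0 hrel).
  set (F := fun s t => v s t * Derive (y s) t - w s t * Derive (x s) t).
  (* Pairing delta = h gamma + c gamma' with gamma' shows that h = [delta,gamma']
     is the only possible coefficient. *)
  assert (unique : forall s h, in_open_interval a b s ->
    is_coefficient c (gamma s) (delta s) h -> forall t, h t = F s t).
  { intros s h hs [_ e] t. specialize (e t).
    assert (e1 : v s t = h t * x s t + c * Derive (x s) t) by exact (f_equal fst e).
    assert (e2 : w s t = h t * y s t + c * Derive (y s) t) by exact (f_equal snd e).
    unfold F. rewrite e1, e2.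
    transitivity (h t * (x s t * Derive (y s) t - Derive (x s) t * y s t)); [|ring].
    rewrite (kdv_wronskian _ _ _ _ _ G s t hs). ring. }
  assert (smooth : forall s, in_open_interval a b s ->
    smooth_fn (x s) /\ smooth_fn (y s) /\ smooth_fn (v s) /\ smooth_fn (w s)).
  { intros s hs.
    exact (conj (lax_smooth (kdv_x _ _ _ _ _ G) s hs)
          (conj (lax_smooth (kdv_y _ _ _ _ _ G) s hs)
          (conj (lax_smooth (kdv_x _ _ _ _ _ D) s hs)
                (lax_smooth (kdv_y _ _ _ _ _ D) s hs)))). }
  split; [intros s hs t; exact (rel s t hs)|]. split.
  - exists F. intros s hs. destruct (smooth s hs) as [sx [sy _]]. split.
    + intros t. unfold F.
      destruct (kdv_antiperiodic _ _ _ _ _ D s t hs) as [-> ->].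
      assert (anti : forall h, smooth_fn h -> (forall t, h (t + PI) = - h t) ->
        Derive h (t + PI) = - Derive h t).
      { intros h sh ah. rewrite <- Derive_opp, <- (Derive_ext _ _ t ah).
        symmetry. apply is_derive_unique.
        assert (d := Derive_correct _ _ (smooth_fn_ex_derive h (t + PI) sh)).
        auto_derive; [now apply smooth_fn_ex_derive|].
        change (Derive (fun x => h x)) with (Derive h). ring. }
      rewrite (anti (y s) sy), (anti (x s) sx); [ring| |];
      intros z; apply (kdv_antiperiodic _ _ _ _ _ G s z hs).
    + intros t. assert (W := kdv_wronskian _ _ _ _ _ G s t hs).
      assert (e1 : v s t = F s t * x s t + c * Derive (x s) t).
      { unfold F. rewrite <- (rel s t hs).
        transitivity (v s t * (x s t * Derive (y s) t - Derive (x s) t * y s t));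
          [rewrite W|]; ring. }
      assert (e2 : w s t = F s t * y s t + c * Derive (y s) t).
      { unfold F. rewrite <- (rel s t hs).
        transitivity (w s t * (x s t * Derive (y s) t - Derive (x s) t * y s t));
          [rewrite W|]; ring. }
      rewrite (surjective_pairing (delta s t)). exact (f_equal2 pair e1 e2).
  - intros f hf.
    assert (fF : forall s t, in_open_interval a b s -> f s t = F s t)
      by (intros s t hs; exact (unique s (f s) hs (hf s hs) t)).
    split.
    + intros t. rewrite fF by exact hs0. symmetry. exact (unique s0 f0 hs0 hf0 t).
    + intros s t hs. destruct (smooth s hs) as [sx [sy [sv sw]]]. split.
      * apply (ex_derive_n_ext (F s)); [intros z; symmetry; now apply fF|].
        apply smooth_fn_minus; apply smooth_fn_mult; auto using smooth_fn_Derive.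
      * rewrite (Derive_n_ext (f s) (F s)) by (intros z; now apply fF).
        rewrite (Derive_ext (f s) (F s)) by (intros z; now apply fF).
        rewrite fF by exact hs.
        apply (is_derive_ext_loc (fun s' => F s' t)).
        -- apply (filter_imp (in_open_interval a b)); [|now apply open_strip].
           intros r hr. symmetry. now apply fF.
        -- exact (coefficient_mkdv a b c p x y q v w hc G D rel s t hs).
Qed.
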